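(* Let $A\in\mathbb{R}^{n\times n}$ be invertible, let $B\in\mathbb{R}^{n\times m}$ have full column rank, let $(A,B)$ be controllable, and let $M\ge 1$ be the number of agents. If $N\ge n+1$, then the model structure $\mathcal{M}(Q,\{\mathscr{P}_t\}_{t=2}^N)$ (defined in the context) is strictly globally identifiable.
   Context: Notation: $\mathbb{S}^n_+$ is the set of symmetric positive semidefinite $n\times n$ real matrices; $\otimes$ is the Kronecker product; $\mathbf{1}$ is the all-one vector; $\prod_{k=1}^{m}A_k := A_mA_{m-1}\cdots A_1$. Closed-loop matrices: for $Q\in\mathbb{S}^n_+$, let $P_2,\dots,P_N$ be defined by the discrete-time Riccati equation $P_N=Q$ and $$P_t=A^TP_{t+1}A+Q-A^TP_{t+1}B(B^TP_{t+1}B+I)^{-1}B^TP_{t+1}A,\quad t=N-1,\dots,2,$$ and put $K_t=-(B^TP_{t+1}B+I)^{-1}B^TP_{t+1}A$ and $A_{cl}(t;Q):=A+BK_t$ for $t=1,\dots,N-1$. (This is the closed-loop system matrix at time $t$ of the finite-horizon LQR problem of minimizing $x_N^TQx_N+\sum_{t=1}^{N-1}(x_t^TQx_t+u_t^Tu_t)$ subject to $x_{t+1}=Ax_t+Bu_t$ with given $x_1$.) Permutation matrices: $\mathcal{P}:=\{\mathscr{P}\in\{0,1\}^{M\times M} : \mathscr{P}\mathbf{1}=\mathbf{1},\ \mathscr{P}^T\mathbf{1}=\mathbf{1}\}$. Model structure: for $Q\in\mathbb{S}^n_+$ and $\mathscr{P}_2,\dots,\mathscr{P}_N\in\mathcal{P}$,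 $$\mathcal{M}(Q,\{\mathscr{P}_t\}_{t=2}^N):=\Big\{\mathscr{P}_t^T\otimes\prod_{k=1}^{t-1}A_{cl}(k;Q)\Big\}_{t=2}^N,$$ a family of matrices indexed by $t=2,\dots,N$. Identifiability: $\mathcal{M}$ is globally identifiable at $(Q',\{\mathscr{P}'_t\}_{t=2}^N)\in\mathbb{S}^n_+\times\mathcal{P}^{N-1}$ if, for all $Q\in\mathbb{S}^n_+$ and $\mathscr{P}_t\in\mathcal{P}$, the equality $\mathcal{M}(Q,\{\mathscr{P}_t\}_{t=2}^N)=\mathcal{M}(Q',\{\mathscr{P}'_t\}_{t=2}^N)$ (equality for every index $t$) implies $Q=Q'$ and $\mathscr{P}_t=\mathscr{P}'_t$ for all $t=2,\dots,N$. $\mathcal{M}$ is strictly globally identifiable if it is globally identifiable at every $(Q',\{\mathscr{P}'_t\}_{t=2}^N)\in\mathbb{S}^n_+\times\mathcal{P}^{N-1}$. *)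

(* Defs.v *)
From HB Require Import structures.
From mathcomp Require Import all_boot all_order all_algebra.
From mathcomp Require Import mxtens reals.

Set Implicit Arguments.
Unset Strict Implicit.
Unset Printing Implicit Defensive.

Import Order.TTheory GRing.Theory Num.Theory.
Local Open Scope ring_scope.

Definition psdmx (R : realType) (n : nat) (S : 'M[R]_n) : Prop :=
  S^T = S /\ forall x : 'cV[R]_n, 0 <= (x^T *m S *m x) 0 0.

Definition permutation_mx (R : realType) (M : nat) (P : 'M[R]_M) : Prop :=
  [/\ forall i j, P i j = 0 \/ P i j = 1,
      P *m const_mx 1 = const_mx 1 :> 'cV[R]_M
    & P^T *m const_mx 1 = const_mx 1 :> 'cV[R]_M].

(* Any state can be steered to any other one in finite time. *)
Definition controllable (R : realType) (n m : nat)
    (A : 'M[R]_n) (B : 'M[R]_(n, m)) : Prop :=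
  forall x0 xf : 'cV[R]_n,
  exists (T : nat) (u : nat -> 'cV[R]_m) (x : nat -> 'cV[R]_n),
    [/\ x 0%N = x0,
        forall t : nat, (t < T)%N -> x t.+1 = A *m x t + B *m u t
      & x T = xf].

Section ClosedLoop.

Variables (R : realType) (n m N : nat) (A : 'M[R]_n) (B : 'M[R]_(n, m)).

Definition riccati_step (Q P : 'M[R]_n) : 'M[R]_n :=
  A^T *m P *m A + Q
  - A^T *m P *m B *m invmx (B^T *m P *m B + 1%:M) *m B^T *m P *m A.

(* The recursion runs backwards from time N; only times t <= N matter. *)
Definition riccati (Q : 'M[R]_n) (t : nat) : 'M[R]_n :=
  iter (N - t) (riccati_step Q) Q.

Lemma riccati_final (Q : 'M[R]_n) : riccati Q N = Q.
Proof. by rewrite /riccati subnn. Qed.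

Lemma riccati_rec (Q : 'M[R]_n) (t : nat) : (t < N)%N ->
  riccati Q t = riccati_step Q (riccati Q t.+1).
Proof. by move=> ltN; rewrite /riccati -(subnSK ltN). Qed.

Definition gain (Q : 'M[R]_n) (t : nat) : 'M[R]_(m, n) :=
  - (invmx (B^T *m riccati Q t.+1 *m B + 1%:M)
     *m B^T *m riccati Q t.+1 *m A).

Definition closed_loop (Q : 'M[R]_n) (t : nat) : 'M[R]_n :=
  A + B *m gain Q t.

End ClosedLoop.

(* F k *m ... *m F 2 *m F 1: later factors multiply on the left. *)
Fixpoint lprod_mx (R : realType) (n : nat) (F : nat -> 'M[R]_n) (k : nat)
    : 'M[R]_n :=
  if k is k'.+1 then F k *m lprod_mx F k' else 1%:M.

Section Identifiability.

Variables (R : realType) (n m M N : nat) (A : 'M[R]_n) (B : 'M[R]_(n, m)).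

(* Families indexed by t = 2, ..., N are functions on nat of which only the
   values at 2 <= t <= N are ever constrained or compared. *)
Definition permutation_family (P : nat -> 'M[R]_M) : Prop :=
  forall t : nat, (2 <= t <= N)%N -> permutation_mx (P t).

(* tensmx is the Kronecker product. *)
Definition model (Q : 'M[R]_n) (P : nat -> 'M[R]_M) (t : nat)
    : 'M[R]_(M * n) :=
  tensmx (P t)^T (lprod_mx (closed_loop N A B Q) t.-1).

Definition globally_identifiable_at
    (Q' : 'M[R]_n) (P' : nat -> 'M[R]_M) : Prop :=
  forall (Q : 'M[R]_n) (P : nat -> 'M[R]_M),
    psdmx Q -> permutation_family P ->
    (forall t : nat, (2 <= t <= N)%N -> model Q P t = model Q' P' t) ->
    Q = Q' /\ forall t : nat, (2 <= t <= N)%N -> P t = P' t.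

Definition strictly_globally_identifiable : Prop :=
  forall (Q' : 'M[R]_n) (P' : nat -> 'M[R]_M),
    psdmx Q' -> permutation_family P' -> globally_identifiable_at Q' P'.

End Identifiability.

(* Main.v *)
(* Each closed-loop matrix is invertible, so the products determine the matrices
   [A_cl(t)], hence the gains [K_t] ([B] is left invertible), and
   [K_t = - B^T P_{t+1} A_cl(t)] then determines [B^T P_{t+1}].  For two cost
   matrices with difference [dQ], the differences [D_t = P_t - P'_t] satisfy
   [D_t B = 0] and therefore [D_t = A^T D_{t+1} A + dQ].  It follows that
   [dQ A^j B = 0] for [j <= N - 2], hence for all [j] by Cayley-Hamilton, and
   [dQ] vanishes on the reachable space.  The permutation factors are recovered
   because a nonzero 0/1 matrix fixes the scale of a Kronecker product. *)
Require Import Defs.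
From mathcomp Require Import all_boot all_order all_algebra.
From mathcomp Require Import mxtens reals zify.
Set Implicit Arguments.
Unset Strict Implicit.
Unset Printing Implicit Defensive.
Import Order.TTheory GRing.Theory Num.Theory.
Local Open Scope ring_scope.

(** * Kronecker products with a 0/1 factor *)

(** Where [P] has entry 1, [P'] cannot have entry 0, or [X] would vanish; so the two blocks there
    are [X] and [X'] themselves. Cancelling a nonzero entry of [X] then recovers [P]. *)
Lemma tensmx_inj01 (R : realType) (m n p q : nat)
    (P P' : 'M[R]_(m, n)) (X X' : 'M[R]_(p, q)) :
  (forall i j, P i j = 0 \/ P i j = 1) ->
  (forall i j, P' i j = 0 \/ P' i j = 1) ->
  P != 0 -> X != 0 -> tensmx P X = tensmx P' X' -> P = P' /\ X = X'.
Proof.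
move=> P01 P'01 /matrix0Pn[i [j Pij]] Xn0 eqT.
have entry a b c d : P a b * X c d = P' a b * X' c d.
  by rewrite -!tensmxE eqT.
have Pij1 : P i j = 1.
  by case: (P01 i j) Pij => // ->; rewrite eqxx.
have eqX : X = X'.
  have [P'0|P'1] := P'01 i j.
    case/negP: Xn0; apply/eqP/matrixP => c d.
    by have := entry i j c d; rewrite Pij1 P'0 mul1r mul0r mxE.
  apply/matrixP => c d.
  by have := entry i j c d; rewrite Pij1 P'1 !mul1r.
split=> //; have [c [d Xcd]] := matrix0Pn _ Xn0.
by apply/matrixP => a b; apply: (mulIf Xcd); rewrite entry eqX.
Qed.

Lemma permutation_mx_tr_neq0 (R : realType) (M : nat) (P : 'M[R]_M) :
  (0 < M)%N -> permutation_mx P -> P^T != 0.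
Proof.
move=> M_gt0 [_ _ P1]; apply/eqP => PT0.
move: P1; rewrite PT0 mul0mx => /matrixP/(_ (Ordinal M_gt0) 0).
by rewrite !mxE => /esym/eqP; rewrite oner_eq0.
Qed.

(** * Semidefiniteness and the Riccati step *)

(** A left kernel vector [v] makes the nonnegative numbers [v S v^T] and [v v^T] sum to 0, so its
    sum of squares vanishes. *)
Lemma psdmx_add1_unit (R : realType) (n : nat) (S : 'M[R]_n) :
  psdmx S -> S + 1%:M \in unitmx.
Proof.
move=> [_ S_ge0]; rewrite -row_free_unit; apply: inj_row_free => v vS0.
have /matrixP/(_ 0 0) : v *m (S + 1%:M) *m v^T = 0 by rewrite vS0 mul0mx.
have := S_ge0 v^T; rewrite trmxK => q_ge0.
have sq_ge0 (j : 'I_n) : true -> 0 <= v 0 j * v^T j 0.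
  by move=> _; rewrite mxE -expr2 sqr_ge0.
rewrite mulmxDr mulmx1 mulmxDl [in LHS]mxE [in RHS]mxE [X in _ + X]mxE.
move/eqP.
rewrite paddr_eq0 //; last exact: sumr_ge0.
case/andP=> _.
rewrite psumr_eq0 // => /allP v0; apply/rowP => j.
have := v0 j (mem_index_enum j); rewrite !mxE mulf_eq0 orbb.
by move/eqP.
Qed.

Lemma psdmxD (R : realType) (n : nat) (S T : 'M[R]_n) :
  psdmx S -> psdmx T -> psdmx (S + T).
Proof.
move=> [ST S0] [TT T0]; split; first by rewrite linearD /= ST TT.
by move=> x; rewrite mulmxDr mulmxDl mxE addr_ge0.
Qed.

Lemma psdmx_congr (R : realType) (n p : nat) (S : 'M[R]_n) (X : 'M[R]_(n, p)) :
  psdmx S -> psdmx (X^T *m S *m X).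
Proof.
move=> [ST S0]; split; first by rewrite !trmx_mul trmxK ST mulmxA.
by move=> x; have := S0 (X *m x); rewrite trmx_mul !mulmxA.
Qed.

Lemma psdmx1 (R : realType) (n : nat) : psdmx (1%:M : 'M[R]_n).
Proof.
split=> [|x]; first exact: trmx1.
by rewrite mulmx1 mxE sumr_ge0 // => i _; rewrite mxE -expr2 sqr_ge0.
Qed.

Section RiccatiStep.

Variables (R : realType) (n m : nat) (A : 'M[R]_n) (B : 'M[R]_(n, m)).
Variables (Q P : 'M[R]_n).
Hypotheses (psdQ : psdmx Q) (psdP : psdmx P).

Let K := - (invmx (B^T *m P *m B + 1%:M) *m B^T *m P *m A).

Lemma gain_normal_eq : (B^T *m P *m B + 1%:M) *m K + B^T *m P *m A = 0.
Proof.
have := psdmx_add1_unit (psdmx_congr B psdP).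
rewrite /K; set S := _ + 1%:M => S_unit.
by rewrite mulmxN -!mulmxA mulKVmx // !mulmxA addNr.
Qed.

(** The normal equation regrouped so that no inverse remains: once the gain and the closed-loop
    matrix are known, this is linear in [B^T P]. *)
Lemma gain_feedback : K = - (B^T *m P *m (A + B *m K)).
Proof.
apply/eqP; rewrite -addr_eq0 -gain_normal_eq mulmxDl mul1mx mulmxDr !mulmxA.
by rewrite [X in K + X]addrC addrA [K + _]addrC.
Qed.

(** Exhibits the closed-loop matrix as a factor of [A], from which it inherits invertibility. *)
Lemma closed_loop_factor : (1%:M + B *m B^T *m P) *m (A + B *m K) = A.
Proof.
rewrite mulmxDl mul1mx -!mulmxA [B^T *m _]mulmxA -addrA -mulmxDr.
have -> : K + B^T *m P *m (A + B *m K) = 0.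
  by apply/eqP; rewrite addr_eq0; apply/eqP/gain_feedback.
by rewrite mulmx0 addr0.
Qed.

Lemma closed_loop_step_unit : A \in unitmx -> A + B *m K \in unitmx.
Proof. by rewrite -{1}closed_loop_factor unitmx_mul => /andP[]. Qed.

Lemma riccati_step_closed_loop :
  riccati_step A B Q P = A^T *m P *m (A + B *m K) + Q.
Proof.
by rewrite /riccati_step /K !mulmxN mulmxDr mulmxN !mulmxA addrAC.
Qed.

(* The Joseph form, whose summands are visibly positive semidefinite. *)
Lemma riccati_step_joseph :
  riccati_step A B Q P =
  (A + B *m K)^T *m P *m (A + B *m K) + K^T *m 1%:M *m K + Q.
Proof.
rewrite riccati_step_closed_loop; congr (_ + _).
rewrite [(A + _)^T]linearD /= trmx_mul 2!mulmxDl -addrA mulmx1.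
have -> : K^T *m K = - (K^T *m B^T *m P *m (A + B *m K)).
  by rewrite [X in _ *m X = _]gain_feedback mulmxN !mulmxA.
by rewrite subrr addr0.
Qed.

Lemma riccati_step_psd : psdmx (riccati_step A B Q P).
Proof.
rewrite riccati_step_joseph; apply: psdmxD => //.
by apply: psdmxD; apply: psdmx_congr => //; apply: psdmx1.
Qed.

End RiccatiStep.

Lemma riccati_psd (R : realType) (n m N : nat) (A : 'M[R]_n)
    (B : 'M[R]_(n, m)) (Q : 'M[R]_n) (t : nat) :
  psdmx Q -> psdmx (riccati N A B Q t).
Proof.
move=> psdQ; rewrite /riccati; elim: (N - t)%N => //= k.
exact: riccati_step_psd.
Qed.

Lemma closed_loop_unit (R : realType) (n m N : nat) (A : 'M[R]_n)
    (B : 'M[R]_(n, m)) (Q : 'M[R]_n) (t : nat) :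
  psdmx Q -> A \in unitmx -> closed_loop N A B Q t \in unitmx.
Proof. by move=> psdQ; apply/closed_loop_step_unit/riccati_psd. Qed.

(** * From products to closed-loop matrices and [B^T P] *)

Lemma lprod_mx_unit (R : realType) (n : nat) (F : nat -> 'M[R]_n) (k : nat) :
  (forall t, F t \in unitmx) -> lprod_mx F k \in unitmx.
Proof.
by move=> Fu; elim: k => [|k IHk] /=; rewrite ?unitmx1 // unitmx_mul Fu.
Qed.

Lemma lprod_mx_inj (R : realType) (n N : nat) (F G : nat -> 'M[R]_n) :
  (forall t, F t \in unitmx) ->
  (forall k, (0 < k < N)%N -> lprod_mx F k = lprod_mx G k) ->
  forall k, (0 < k < N)%N -> F k = G k.
Proof.
move=> Fu eqL [//|k] kN.
have eqLk : lprod_mx F k = lprod_mx G k.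
  (* The empty product lies outside the range of [eqL], but is the identity on both sides. *)
  by case: k kN => [_|k kN]; [exact: erefl | apply: eqL; apply: ltnW].
apply: (can_inj (mulmxK (lprod_mx_unit k Fu))).
by rewrite -[LHS]/(lprod_mx F k.+1) eqL //= eqLk.
Qed.

Lemma unitmx_neq0 (R : realType) (n : nat) (X : 'M[R]_n) :
  (0 < n)%N -> X \in unitmx -> X != 0.
Proof.
case: n X => // n X _ Xu; apply/eqP => X0; move: Xu.
by rewrite X0 unitmxE det0 unitr0.
Qed.

Lemma full_col_rank_inj (R : realType) (n m p : nat) (B : 'M[R]_(n, m))
    (X Y : 'M[R]_(m, p)) :
  \rank B = m -> B *m X = B *m Y -> X = Y.
Proof.
move=> rB eqBX; apply: trmx_inj; apply: (@row_free_inj _ _ _ _ B^T).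
  by rewrite /row_free mxrank_tr rB.
by rewrite -!trmx_mul eqBX.
Qed.

Lemma gain_determines_riccati (R : realType) (n m N : nat) (A : 'M[R]_n)
    (B : 'M[R]_(n, m)) (Q Q' : 'M[R]_n) (t : nat) :
  A \in unitmx -> \rank B = m -> psdmx Q -> psdmx Q' ->
  closed_loop N A B Q t = closed_loop N A B Q' t ->
  B^T *m riccati N A B Q t.+1 = B^T *m riccati N A B Q' t.+1.
Proof.
move=> Au rB psdQ psdQ' eqC.
have eqK : gain N A B Q t = gain N A B Q' t.
  by apply: (full_col_rank_inj rB); apply: (addrI A).
have Cu := closed_loop_unit N B t psdQ Au.
apply: (can_inj (mulmxK Cu)).
apply: oppr_inj; rewrite [in RHS]eqC.
have feed S : psdmx S -> gain N A B S t =
    - (B^T *m riccati N A B S t.+1 *m closed_loop N A B S t).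
  by move=> psdS; apply: gain_feedback; apply: riccati_psd.
by rewrite -(feed Q psdQ) -(feed Q' psdQ').
Qed.

(** * Annihilating the reachable space *)

(** By Cayley-Hamilton, [A ^+ k] is the value at [A] of the remainder of ['X^k] modulo the
    characteristic polynomial, which has degree at most [n]. *)
Lemma expmx_annihilate (R : realType) (n m : nat) (A : 'M[R]_n.+1)
    (B : 'M[R]_(n.+1, m)) (D : 'M[R]_n.+1) :
  (forall j, (j <= n)%N -> D *m A ^+ j *m B = 0) ->
  forall k, D *m A ^+ k *m B = 0.
Proof.
move=> low k; pose p := 'X^k %% char_poly A.
have -> : A ^+ k = horner_mx A p.
  rewrite -[A in LHS](horner_mx_X A) -rmorphXn /=.
  rewrite {1}(divp_eq 'X^k (char_poly A)).
  by rewrite rmorphD rmorphM /= Cayley_Hamilton mulr0 add0r.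
have sz : (size p <= n.+1)%N.
  by rewrite -ltnS -(size_char_poly A) ltn_modp -size_poly_eq0 size_char_poly.
rewrite -[p]coefK poly_def rmorph_sum /= mulmx_sumr mulmx_suml big1 // => i _.
rewrite linearZ /= rmorphXn /= horner_mx_X -scalemxAr -scalemxAl.
rewrite low ?scaler0 //.
by rewrite -ltnS (leq_trans (ltn_ord i)).
Qed.

Lemma controllable_annihilator (R : realType) (n m : nat) (A : 'M[R]_n.+1)
    (B : 'M[R]_(n.+1, m)) (D : 'M[R]_n.+1) :
  controllable A B -> (forall k, D *m A ^+ k *m B = 0) -> D = 0.
Proof.
move=> ctrl annih; suff D_col (xf : 'cV[R]_n.+1) : D *m xf = 0.
  apply/matrixP => i j; have /matrixP/(_ i 0) := D_col (delta_mx j 0).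
  by rewrite -colE !mxE.
have [T [u [x [x0 step <-]]]] := ctrl 0 xf.
(* Induction along a trajectory from 0 to [xf]; all [k] are needed at once because each time step
   raises the exponent. *)
suff reach t : (t <= T)%N -> forall k, D *m A ^+ k *m x t = 0.
  by have := reach T (leqnn T) 0%N; rewrite expr0 mulmx1.
elim: t => [|t IHt] tT k; first by rewrite x0 mulmx0.
rewrite step // mulmxDr !mulmxA annih mul0mx addr0.
by rewrite -[D *m _ *m A]mulmxA -[A ^+ k *m A]exprSr IHt // ltnW.
Qed.

(** In the increments of [E] the constant term cancels, leaving [(A ^+ j.+1)^T D A ^+ j.+1]. These
    also kill [B], and the invertible left factor cancels. *)
Lemma stein_annihilate (R : realType) (n m k : nat) (A D : 'M[R]_n.+1)
    (B : 'M[R]_(n.+1, m)) (E : nat -> 'M[R]_n.+1) :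
  A \in unitmx -> E 0%N = D ->
  (forall j, (j < k)%N -> E j.+1 = A^T *m E j *m A + D) ->
  (forall j, (j <= k)%N -> E j *m B = 0) ->
  forall j, (j <= k)%N -> D *m A ^+ j *m B = 0.
Proof.
move=> Au E0 ES EB.
have diffE j : (j < k)%N -> E j.+1 - E j = (A ^+ j.+1)^T *m D *m A ^+ j.+1.
  elim: j => [|j IHj] jk; first by rewrite ES // E0 expr1 addrK.
  rewrite ES // [X in _ - X]ES ?(ltnW jk) // opprD addrACA subrr addr0.
  rewrite -mulmxBl -mulmxBr IHj ?(ltnW jk) // [A ^+ j.+2]exprSr.
  by rewrite [in RHS]trmx_mul !mulmxA.
case=> [_|j jk]; first by rewrite expr0 mulmx1 -E0 EB.
have AjT_unit : (A ^+ j.+1)^T \in unitmx by rewrite unitmx_tr; apply: unitrX.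
apply: (can_inj (mulKmx AjT_unit)); rewrite mulmx0 !mulmxA -diffE //.
by rewrite mulmxBl !EB ?subrr // ltnW.
Qed.

Lemma riccati_closed_loop_rec (R : realType) (n m N : nat) (A : 'M[R]_n)
    (B : 'M[R]_(n, m)) (Q : 'M[R]_n) (t : nat) :
  (t < N)%N ->
  riccati N A B Q t = A^T *m riccati N A B Q t.+1 *m closed_loop N A B Q t + Q.
Proof.
by move=> tN; rewrite riccati_rec // riccati_step_closed_loop.
Qed.

(** With a common closed-loop matrix [A + B K] the difference is linear, and [D B = 0] removes the
    feedback term [D B K], leaving the open-loop [A]. *)
Lemma riccati_sub_rec (R : realType) (n m N : nat) (A : 'M[R]_n)
    (B : 'M[R]_(n, m)) (Q Q' : 'M[R]_n) (t : nat) :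
  (t < N)%N ->
  closed_loop N A B Q t = closed_loop N A B Q' t ->
  (riccati N A B Q t.+1 - riccati N A B Q' t.+1) *m B = 0 ->
  riccati N A B Q t - riccati N A B Q' t =
  A^T *m (riccati N A B Q t.+1 - riccati N A B Q' t.+1) *m A + (Q - Q').
Proof.
move=> tN eqC DB0.
rewrite (riccati_closed_loop_rec _ _ Q tN) (riccati_closed_loop_rec _ _ Q' tN).
rewrite -eqC opprD addrACA -mulmxBl -mulmxBr; congr (_ + _).
move: DB0; rewrite /closed_loop; set D := _ - _ => DB0.
by rewrite mulmxDr mulmxA -[_ *m D *m B]mulmxA DB0 mulmx0 mul0mx addr0.
Qed.

Theorem proposition2p1 (R : realType) (n m M N : nat)
    (A : 'M[R]_n) (B : 'M[R]_(n, m))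
    (n_gt0 : (0 < n)%N) (M_gt0 : (1 <= M)%N)
    (A_inv : A \in unitmx)
    (B_full_col_rank : \rank B = m)
    (AB_controllable : controllable A B)
    (N_ge : (n + 1 <= N)%N) :
  strictly_globally_identifiable M N A B.
Proof.
move=> Q' P' psdQ' permP' Q P psdQ permP eqM.
pose F S := closed_loop N A B S.
have Fu S t : psdmx S -> F S t \in unitmx by move=> ?; apply: closed_loop_unit.
have eqPF t : (2 <= t <= N)%N ->
    P t = P' t /\ lprod_mx (F Q) t.-1 = lprod_mx (F Q') t.-1.
  move=> tN; have [P01 _ _] := permP _ tN; have [P'01 _ _] := permP' _ tN.
  have [| | | | eqP eqL] := tensmx_inj01 _ _ _ _ (eqM t tN).
  - by move=> i j; rewrite mxE; apply: P01.
  - by move=> i j; rewrite mxE; apply: P'01.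
  - exact: permutation_mx_tr_neq0 (permP _ tN).
  - by apply: unitmx_neq0 => //; apply: lprod_mx_unit => k; apply: Fu.
  - by split=> //; apply: trmx_inj.
split; last by move=> t /eqPF[].
have eqF k : (0 < k < N)%N -> F Q k = F Q' k.
  apply: lprod_mx_inj; first by move=> t; apply: Fu.
  (* The product of the first [k] factors sits at index [k.+1] of the model. *)
  by move=> {}k kN; apply: (eqPF k.+1 _).2.
pose D t := riccati N A B Q t - riccati N A B Q' t.
have DB0 t : (2 <= t <= N)%N -> D t *m B = 0.
  case: t => [//|[//|t]] tN.
  have DT : (D t.+2)^T = D t.+2.
    have [QT _] := riccati_psd N A B t.+2 psdQ.
    have [Q'T _] := riccati_psd N A B t.+2 psdQ'.
    by rewrite linearB /= QT Q'T.
  (* The gains give [B^T D = 0]; symmetry of [D] turns this into [D B = 0]. *)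
  apply: trmx_inj; rewrite trmx_mul DT trmx0 mulmxBr; apply/eqP.
  by rewrite subr_eq0; apply/eqP/gain_determines_riccati => //; apply: eqF.
have D_rec t : (2 <= t < N)%N -> D t = A^T *m D t.+1 *m A + (Q - Q').
  move=> /andP[t2 tN]; apply: riccati_sub_rec => //.
    by apply: eqF; rewrite tN ltnW.
  by apply: DB0; rewrite tN ltnW.
have DN : D N = Q - Q' by rewrite /D !riccati_final.
apply/eqP; rewrite -subr_eq0; apply/eqP.
clearbody D; clear - n_gt0 A_inv AB_controllable N_ge DB0 D_rec DN.
case: n => [//|n] in A B Q Q' D n_gt0 A_inv AB_controllable N_ge DB0 D_rec DN *.
apply: (controllable_annihilator AB_controllable); apply: expmx_annihilate.
(* Time is reversed to start at [D N = Q - Q']. The dimension is now [n.+1], so [N >= n + 2] and the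
   times [N - i] with [i <= n] stay at least 2, where [DB0] applies. *)
apply: (@stein_annihilate _ _ _ n _ _ _ (fun i => D (N - i)%N)) => //.
- by rewrite subn0.
- move=> i i_n; rewrite D_rec; last by lia.
  by congr (_ *m D _ *m _ + _); lia.
- by move=> i i_n; apply: DB0; lia.
Qed.
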